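(* Let $f: \mathbb{R}^n \to \mathbb{R}^n$ be a generalized social shrinkage operator and $N_i \subset \{1,\dots,n\}$, $w^i \in \mathbb{R}^n_+$, $i \in \{1,\dots,n\}$, be the corresponding families of neighborhoods and weight vectors. If $f$ is a proximity operator (of some $\varphi:\mathbb{R}^n\to\mathbb{R}\cup\{+\infty\}$) then there exists a partition $\mathcal{G} = \{G_{p}\}_{p=1}^{P}$ of the set $\{1,\dots,n\}$ of indices such that: for each $p$ and all $i,j \in G_{p}$ we have $w^{i}=w^{j}$ and $\mathrm{supp}(w^{i}) = \mathrm{supp}(w^{j}) = G_{p}$. As a consequence, for $i \in G_{p}$, $j \in G_{q}$ with $p \neq q$, the weight vectors $w^{i}$ and $w^{j}$ have disjoint support.
   Context: Generalized social shrinkage operator: consider subsets $N_i\subset\{1,\dots,n\}$ and nonnegative weight vectors $w^i\in\mathbb{R}_+^n$ with $i\in N_i$ and $\mathrm{supp}(w^i)=N_i$ for each $i$; consider $\lambda>0$ and a family of scalar functions $h_i$, $i\in\{1,\dots,n\}$, that are $C^1$ on $(0,+\infty)$ with $h_i'(t)\neq0$ for all $t>0$. The associated operator is $f(y)=(f_i(y))_{i=1}^n$ with $f_i(y)=y_i\,h_i\left(\|\mathrm{diag}(w^i)y\|_2^2\right)$ if $\|\mathrm{diag}(w^i)y\|_2>\lambda$, and $f_i(y)=0$ otherwise. $\mathrm{diag}(w)$ is the diagonal matrix with diagonal $w$ and $\mathrm{supp}(w)=\{\ell:w_\ell\neq0\}$. $\mathrm{prox}_\varphi(y) := \arg\min_{x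 \in \mathbb{R}^n} \{\tfrac12\|y-x\|_2^2 + \varphi(x)\}$ is the set of global minimizers (a minimizer is required to have finite objective value); $f$ is a proximity operator of $\varphi$ if $f(y)\in\mathrm{prox}_\varphi(y)$ for all $y\in\mathbb{R}^n$. *)

(* Defs.v *)
From HB Require Import structures.
From mathcomp Require Import all_boot all_order all_algebra.
From mathcomp Require Import all_classical all_reals all_analysis.
Set Implicit Arguments.
Unset Strict Implicit.
Unset Printing Implicit Defensive.
Import Order.TTheory GRing.Theory Num.Theory.
Import numFieldNormedType.Exports.
Local Open Scope classical_set_scope.
Local Open Scope ring_scope.

(* The norm `|x| that MathComp-Analysis puts on matrices is the sup norm, hence
   a separate Euclidean norm. *)
Definition norm2 (R : realType) (n : nat) (x : 'cV[R]_n) : R :=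
  Num.sqrt (\sum_(i < n) x i 0 ^+ 2).

Definition supp (R : realType) (n : nat) (w : 'cV[R]_n) : {set 'I_n} :=
  [set l | w l 0 != 0]%SET.

Definition prox_objective (R : realType) (n : nat) (phi : 'cV[R]_n -> \bar R)
    (y x : 'cV[R]_n) : \bar R :=
  ((2^-1 * norm2 (y - x) ^+ 2)%:E + phi x)%E.

Definition prox (R : realType) (n : nat) (phi : 'cV[R]_n -> \bar R)
    (y : 'cV[R]_n) : set 'cV[R]_n :=
  [set x | prox_objective phi y x \is a fin_num /\
     forall z, (prox_objective phi y x <= prox_objective phi y z)%E].

Definition is_prox_of (R : realType) (n : nat) (phi : 'cV[R]_n -> \bar R)
    (f : 'cV[R]_n -> 'cV[R]_n) : Prop :=
  forall y, prox phi y (f y).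

(* The condition on phi expresses that its values are in R \cup {+oo}. *)
Definition is_prox (R : realType) (n : nat) (f : 'cV[R]_n -> 'cV[R]_n) : Prop :=
  exists phi : 'cV[R]_n -> \bar R,
    (forall x, phi x <> -oo%E) /\ is_prox_of phi f.

Definition C1_pos (R : realType) (h : R -> R) : Prop :=
  forall t : R, 0 < t -> derivable h t 1 /\ {for t, continuous (derive1 h)}.

Definition weighted_norm (R : realType) (n : nat) (w y : 'cV[R]_n) : R :=
  norm2 (diag_mx w^T *m y).

(* Each h i is total on R, but only its restriction to (0, +oo) matters, since
   it is evaluated only where weighted_norm (w i) y > lambda > 0. *)
Record social_shrinkage (R : realType) (n : nat) (N : 'I_n -> {set 'I_n})
    (w : 'I_n -> 'cV[R]_n) (lambda : R) (h : 'I_n -> R -> R)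
    (f : 'cV[R]_n -> 'cV[R]_n) : Prop := SocialShrinkage {
  ss_mem : forall i, i \in N i;
  ss_weight_ge0 : forall i l, 0 <= w i l 0;
  ss_supp : forall i, supp (w i) = N i;
  ss_lambda_gt0 : 0 < lambda;
  ss_C1 : forall i, C1_pos (h i);
  ss_deriv_neq0 : forall i (t : R), 0 < t -> derive1 (h i) t != 0;
  ss_opE : forall y i,
    f y i 0 = if lambda < weighted_norm (w i) y
              then y i 0 * h i (weighted_norm (w i) y ^+ 2) else 0 }.

(* Main.v *)
(** Proximity operators are monotone. Suppose [j] is in the support of [w i]
    while some nonnegative [y] satisfies [weighted_norm (w j) y < lambda <
    weighted_norm (w i) y]. Near [y] the component [f_j] vanishes, so
    monotonicity within the plane spanned by [e_i] and [e_j] says that [f_i]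
    increases along [e_i] no matter how the [j]-th coordinate is changed; as
    [f_i] is continuous there, it does not depend on that coordinate. But the
    [j]-th coordinate does change the argument of [h_i], so [h_i] takes the same
    value at two distinct points, against [h_i' != 0] and Rolle's theorem.
    Testing the resulting implication on multiples of the basis vectors gives
    [w i <= w j] entrywise; then [i] is in the support of [w j], so [w i = w j]
    by symmetry. *)
Require Import Defs.
From HB Require Import structures.
From mathcomp Require Import all_boot all_order all_algebra.
From mathcomp Require Import all_classical all_reals all_analysis.
From mathcomp Require Import ring lra.
Set Implicit Arguments.
Unset Strict Implicit.
Import Order.TTheory GRing.Theory Num.Theory.
Import numFieldNormedType.Exports.
Local Open Scope ring_scope.

Lemma norm2_sqr (R : realType) (n : nat) (x : 'cV[R]_n) :
  norm2 x ^+ 2 = \sum_(i < n) x i 0 ^+ 2.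
Proof. by rewrite sqr_sqrtr // sumr_ge0 // => i _; rewrite sqr_ge0. Qed.

Lemma weighted_norm_ge0 (R : realType) (n : nat) (w y : 'cV[R]_n) :
  0 <= weighted_norm w y.
Proof. exact: sqrtr_ge0. Qed.

Lemma weighted_norm_sqr (R : realType) (n : nat) (w y : 'cV[R]_n) :
  weighted_norm w y ^+ 2 = \sum_(i < n) (w i 0 * y i 0) ^+ 2.
Proof.
rewrite norm2_sqr; apply: eq_bigr => i _.
by rewrite mul_diag_mx !mxE.
Qed.

Lemma weighted_norm_sqrD (R : realType) (n : nat) (w y : 'cV[R]_n)
    (k : 'I_n) (s : R) :
  weighted_norm w (y + s *: delta_mx k 0) ^+ 2 =
  weighted_norm w y ^+ 2 + w k 0 ^+ 2 * (2 * y k 0 * s + s ^+ 2).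
Proof.
rewrite !weighted_norm_sqr (bigD1 k) //= [in RHS](bigD1 k) //=.
rewrite !mxE !eqxx /= addrAC; congr (_ + _); first by ring.
apply: eq_bigr => i /negbTE ik; by rewrite !mxE ik mulr0 addr0.
Qed.

Lemma weighted_normZdelta (R : realType) (n : nat) (w : 'cV[R]_n)
    (k : 'I_n) (s : R) :
  weighted_norm w (s *: delta_mx k 0) ^+ 2 = (w k 0 * s) ^+ 2.
Proof.
rewrite -[s *: _]add0r weighted_norm_sqrD mxE weighted_norm_sqr big1 => [|i _].
  by ring.
by rewrite mxE mulr0 expr0n.
Qed.

(** Add the minimality of [f y] tested against [f z] to that of [f z] tested against [f y]. The
    values of [phi] at both points are finite, so they cancel, and expanding the squares leaves the
    inner product. *)
Lemma is_prox_monotone (R : realType) (n : nat) (f : 'cV[R]_n -> 'cV[R]_n) :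
  is_prox f -> forall y z : 'cV[R]_n,
  0 <= \sum_(i < n) (y - z) i 0 * (f y - f z) i 0.
Proof.
move=> [phi [_ fphi]] y z.
have [yfin ymin] := fphi y; have [zfin zmin] := fphi z.
move: yfin zfin (ymin (f z)) (zmin (f y)); rewrite /prox_objective.
rewrite !fin_numD /= => /fineK <- /fineK <-.
rewrite -!EFinD !lee_fin !norm2_sqr => ley lez.
suff -> : \sum_(i < n) (y - z) i 0 * (f y - f z) i 0 =
    2^-1 * (\sum_(i < n) (y - f z) i 0 ^+ 2 + \sum_(i < n) (z - f y) i 0 ^+ 2
    - \sum_(i < n) (y - f y) i 0 ^+ 2 - \sum_(i < n) (z - f z) i 0 ^+ 2).
  by lra.
rewrite -!sumrN -!big_split mulr_sumr /=; apply: eq_bigr => i _.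
by rewrite !mxE; field.
Qed.

(** Only the coordinates [i] and [j] enter the inner product, and the [j] term vanishes because [f]
    has equal [j]-th components. Hence the shift [s] may have any sign and size. *)
Lemma shift2_monotone (R : realType) (n : nat) (f : 'cV[R]_n -> 'cV[R]_n)
    (y z : 'cV[R]_n) (i j : 'I_n) (t s : R) :
  (forall y z : 'cV[R]_n, 0 <= \sum_(i < n) (y - z) i 0 * (f y - f z) i 0) ->
  z - y = t *: delta_mx i 0 + s *: delta_mx j 0 ->
  f y j 0 = f z j 0 -> 0 < t -> f y i 0 <= f z i 0.
Proof.
move=> /(_ z y) + zy fj t_gt0; rewrite zy.
have -> : \sum_(k < n) (t *: delta_mx i 0 + s *: delta_mx j 0 : 'cV[R]_n) k 0
    * (f z - f y) k 0 = t * (f z i 0 - f y i 0).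
  rewrite (bigD1 i) //= big1 => [|k ki].
    rewrite !mxE eqxx /= addr0 mulr1.
    case: eqVneq => [ij|_] /=; first by rewrite ij fj subrr !mulr0.
    by rewrite mulr0 addr0.
  rewrite !mxE (negbTE ki) /= mulr0 add0r.
  by case: eqVneq => [->|_] /=; rewrite ?fj ?subrr ?mulr0 ?mul0r.
by rewrite pmulr_rge0 // subr_ge0.
Qed.

Lemma deriv_neq0_inj (R : realType) (h : R -> R) (a b : R) :
  C1_pos h -> (forall t, 0 < t -> derive1 h t != 0) ->
  0 < a -> a < b -> h a <> h b.
Proof.
move=> hC1 h'0 a0 ab hab.
have dh x : a <= x -> derivable h x 1.
  by move=> ax; apply: (hC1 x _).1; exact: lt_le_trans ax.
have [|||c] := @Rolle R h a b ab.
- by move=> x; rewrite in_itv => /andP[/ltW/dh].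
- by apply: derivable_within_continuous => x; rewrite in_itv => /andP[/dh].
- exact: hab.
rewrite in_itv => /andP[ac _] hc; have /eqP := h'0 c (lt_trans a0 ac).
by rewrite derive1E derive_val.
Qed.

Section ActiveRegions.

Variables (R : realType) (n : nat) (N : 'I_n -> {set 'I_n}).
Variables (w : 'I_n -> 'cV[R]_n) (lambda : R) (h : 'I_n -> R -> R).
Variable f : 'cV[R]_n -> 'cV[R]_n.
Hypotheses (fS : social_shrinkage N w lambda h f) (fprox : is_prox f).

Lemma lambda_lt_sqr (i : 'I_n) (y : 'cV[R]_n) :
  (lambda < weighted_norm (w i) y) =
  (lambda ^+ 2 < weighted_norm (w i) y ^+ 2).
Proof.
by rewrite ltr_pXn2r // nnegrE ?weighted_norm_ge0 // ltW // (ss_lambda_gt0 fS).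
Qed.

Lemma active_region_sub (i j : 'I_n) (y : 'cV[R]_n) : i != j -> w i j 0 != 0 ->
  (forall k, 0 <= y k 0) ->
  lambda < weighted_norm (w i) y -> lambda <= weighted_norm (w j) y.
Proof.
move=> ij wij y_ge0 li; rewrite leNgt; apply/negP => lj.
have l0 := ss_lambda_gt0 fS.
have yi := y_ge0 i; have yj := y_ge0 j.
(* [X] parametrizes the plane through [y], and [q k] is the squared [k]-th weighted norm on it,
   nondecreasing in [t, s >= 0] since [y] is nonnegative. *)
pose X t s := y + t *: delta_mx i 0 + s *: delta_mx j 0.
pose q k t s := weighted_norm (w k) y ^+ 2
  + w k i 0 ^+ 2 * (2 * y i 0 * t + t ^+ 2)
  + w k j 0 ^+ 2 * (2 * y j 0 * s + s ^+ 2).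
have qE k t s : weighted_norm (w k) (X t s) ^+ 2 = q k t s.
  rewrite !weighted_norm_sqrD !mxE [j == i]eq_sym (negbTE ij).
  by rewrite mulr0 addr0.
have q_homo k t s t' s' : 0 <= t -> t <= t' -> 0 <= s -> s <= s' ->
    q k t s <= q k t' s'.
  move=> t0 tt' s0 ss'; apply: lerD; first apply: lerD => //.
    by apply: ler_wpM2l; [exact: sqr_ge0 | nra].
  by apply: ler_wpM2l; [exact: sqr_ge0 | nra].
(* Since [q j] is nondecreasing, control at the corner [(d, d)] makes [f_j] vanish on the whole
   square [[0, d]^2]. *)
have [d d0 qd] : exists2 d, 0 < d & q j d d < lambda ^+ 2.
  have q0 : q j 0 0 < lambda ^+ 2.
    have := weighted_norm_ge0 (w j) y; rewrite /q; nra.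
  have qc : {for 0, continuous (fun d => q j d d)}.
    rewrite /q; apply: cvgD; [apply: cvgD; first exact: cvg_cst|];
    apply: cvgM; try exact: cvg_cst; apply: cvgD.
    - by apply: cvgM; [exact: cvg_cst|exact: cvg_id].
    - by apply: cvgM; exact: cvg_id.
    - by apply: cvgM; [exact: cvg_cst|exact: cvg_id].
    - by apply: cvgM; exact: cvg_id.
  near ((0 : R)^'+)%classic => d; exists d => //.
  by near: d; apply: cvgr_lt q0; exact: cvg_at_right_filter.
have qi_gt t s : 0 <= t -> 0 <= s -> lambda ^+ 2 < q i t s.
  move=> t0 s0; apply: lt_le_trans (q_homo i 0 0 t s _ t0 _ s0) => //.
  rewrite -qE /X !scale0r !addr0 -lambda_lt_sqr //.
pose F s t := (y i 0 + t) * h i (q i t s).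
have fXi t s : 0 <= t -> 0 <= s -> f (X t s) i 0 = F s t.
  move=> t0 s0; rewrite (ss_opE fS) lambda_lt_sqr qE qi_gt //.
  by rewrite !mxE eqxx (negbTE ij) mulr1 mulr0 addr0.
have fXj t s : 0 <= t <= d -> 0 <= s <= d -> f (X t s) j 0 = 0.
  move=> /andP[t0 td] /andP[s0 sd]; rewrite (ss_opE fS) lambda_lt_sqr qE.
  by rewrite ltNge ltW // (le_lt_trans (q_homo _ _ _ _ _ t0 td s0 sd)).
(* The increase in [t] is strict, while [s] and [s'] are unrelated. *)
have F_homo t t' s s' : 0 <= t -> t < t' -> t' <= d ->
    0 <= s <= d -> 0 <= s' <= d -> F s t <= F s' t'.
  move=> t0 tt' t'd sd s'd.
  have /andP[s0 _] := sd; have /andP[s'0 _] := s'd.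
  rewrite -!fXi ?(le_trans t0 (ltW tt')) //.
  apply: (@shift2_monotone _ _ f _ _ i j (t' - t) (s' - s)).
  - exact: is_prox_monotone.
  - by apply/colP => k; rewrite /X !mxE; ring.
  - rewrite !fXj // ?t0 ?t'd ?(le_trans t0 (ltW tt')) //.
    exact: le_trans (ltW tt') t'd.
  - by rewrite subr_gt0.
(* An interior point: [e < d] leaves room for a limit from the right, and [e > 0] makes the factor
   [y i 0 + e] nonzero even when [y i 0 = 0]. *)
pose e := d / 2.
have e0 : 0 < e by rewrite divr_gt0.
have ed : e < d by rewrite /e; lra.
have F_cont s : 0 <= s -> {for e, continuous (F s)}.
  move=> s0; apply: cvgM; first by apply: cvgD; [exact: cvg_cst|exact: cvg_id].
  apply: (@continuous_comp _ _ _ (fun t => q i t s) (h i)).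
    rewrite /q; apply: cvgD; [apply: cvgD; first exact: cvg_cst|exact: cvg_cst].
    apply: cvgM; first exact: cvg_cst.
    apply: cvgD; first by apply: cvgM; [exact: cvg_cst|exact: cvg_id].
    by apply: cvgM; exact: cvg_id.
  apply/differentiable_continuous/derivable1_diffP.
  by apply: (ss_C1 fS i _).1; rewrite (lt_trans _ (qi_gt _ _ (ltW e0) s0)) //
    exprn_gt0.
(* Let [t] decrease to [e] in [F s e <= F s' t]. Exchanging [s] and [s'] then gives equality. *)
have F_le s s' : 0 <= s <= d -> 0 <= s' <= d -> F s e <= F s' e.
  move=> sd s'd; have /andP[s'0 _] := s'd.
  have Fc : (F s' t @[t --> e^'+] --> F s' e)%classic.
    exact/cvg_at_right_filter/F_cont.
  rewrite -(cvg_lim _ Fc) //; apply: limr_ge.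
    by apply/cvg_ex; exists (F s' e).
  near=> t; apply: F_homo => //; first exact: ltW.
  by near: t; exact: nbhs_right_le.
have d_itv : 0 <= d <= d by rewrite ltW /=.
have z_itv : (0 : R) <= 0 <= d by rewrite lexx ltW.
have /eqP : F 0 e = F d e by apply/eqP; rewrite eq_le !F_le.
rewrite /F => /eqP /mulfI hq.
apply: (@deriv_neq0_inj _ (h i) (q i e 0) (q i e d)).
- exact: ss_C1 fS i.
- exact: ss_deriv_neq0 fS i.
- by rewrite (lt_trans _ (qi_gt _ _ (ltW e0) _)) // exprn_gt0.
- rewrite /q ltrD2l expr0n mulr0 addr0 mulr0 pmulr_rgt0; first by nra.
  by rewrite lt0r sqr_ge0 sqrf_eq0 wij.
- by apply: hq; rewrite gt_eqF //; lra.
Unshelve. all: by end_near.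
Qed.

Lemma weight_le i j : j \in N i -> forall l, w i l 0 <= w j l 0.
Proof.
move=> jNi l; have [->//|ij] := eqVneq i j.
have wij : w i j 0 != 0 by move: jNi; rewrite -(ss_supp fS) inE.
have [il jl] := (ss_weight_ge0 fS i l, ss_weight_ge0 fS j l).
have l0 := ss_lambda_gt0 fS.
rewrite leNgt; apply/negP => ltw.
(* This scaling puts [lambda] at the midpoint of [c * w j l 0] and [c * w i l 0], so it separates
   them strictly. *)
pose c := 2 * lambda / (w i l 0 + w j l 0).
have c0 : 0 < c by rewrite /c divr_gt0; lra.
have cE : c * (w i l 0 + w j l 0) = 2 * lambda.
  by rewrite /c divfK // gt_eqF //; lra.
have cw : 0 < c * (w i l 0 - w j l 0) by rewrite mulr_gt0 ?subr_gt0.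
have li : lambda < w i l 0 * c by lra.
have lj : w j l 0 * c < lambda by lra.
have y0 k : 0 <= (c *: delta_mx l 0 : 'cV[R]_n) k 0.
  by rewrite !mxE mulr_ge0 // ?ler0n // ltW.
have /(active_region_sub ij wij y0) :
    lambda < weighted_norm (w i) (c *: delta_mx l 0).
  by rewrite lambda_lt_sqr weighted_normZdelta ltr_pXn2r // nnegrE; lra.
rewrite leNgt => /negP; apply.
rewrite -(@ltr_pXn2r _ 2) ?nnegrE ?weighted_norm_ge0 ?(ltW l0) //.
by rewrite weighted_normZdelta ltr_pXn2r // nnegrE; nra.
Qed.

Lemma weight_eq i j : j \in N i -> w i = w j.
Proof.
move=> jNi; have le_ij := weight_le jNi.
(* [w i i 0] is positive because [i] belongs to [N i], and it is at most [w j i 0]. *)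
have iNj : i \in N j.
  rewrite -(ss_supp fS) inE gt_eqF // (lt_le_trans _ (le_ij i)) //.
  rewrite lt0r (ss_weight_ge0 fS) andbT.
  by have := ss_mem fS i; rewrite -(ss_supp fS) inE.
by apply/colP => l; apply/eqP; rewrite eq_le le_ij weight_le.
Qed.

Lemma neighborhood_eq i j : j \in N i -> N i = N j.
Proof. by move=> /weight_eq wij; rewrite -!(ss_supp fS) wij. Qed.

End ActiveRegions.

Theorem lemma2 (R : realType) (n : nat) (N : 'I_n -> {set 'I_n})
    (w : 'I_n -> 'cV[R]_n) (lambda : R) (h : 'I_n -> R -> R)
    (f : 'cV[R]_n -> 'cV[R]_n)
    (fS : social_shrinkage N w lambda h f) (fprox : is_prox f) :
  exists G : {set {set 'I_n}},
    [/\ finset.partition G [set: 'I_n]%SET,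
        (forall Gp, Gp \in G -> forall i j, i \in Gp -> j \in Gp ->
           [/\ w i = w j, supp (w i) = Gp & supp (w j) = Gp])
      & (forall Gp Gq, Gp \in G -> Gq \in G -> Gp != Gq ->
           forall i j, i \in Gp -> j \in Gq ->
             [disjoint supp (w i) & supp (w j)])].
Proof.
have N_eq (i j : 'I_n) (ji : j \in N i) := neighborhood_eq fS fprox ji.
have w_eq (i j : 'I_n) (ji : j \in N i) := weight_eq fS fprox ji.
(* A common element [k] would force both neighborhoods to equal [N k]. *)
have N_disj i j : N i != N j -> [disjoint N i & N j].
  apply: contraR; rewrite -setI_eq0 => /set0Pn[k /setIP[ki kj]].
  by rewrite (N_eq _ _ ki) (N_eq _ _ kj).
(* The blocks are the neighborhoods themselves; [i \in N i] makes them cover all indices and be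
   nonempty. *)
exists [set N i | i in 'I_n]%SET; split.
- apply/and3P; split.
  + apply/eqP/setP => i; rewrite inE; apply/finset.bigcupP.
    by exists (N i); [exact: imset_f | exact: ss_mem fS i].
  + by apply/finset.trivIsetP => _ _ /imsetP[i _ ->] /imsetP[j _ ->]; exact: N_disj.
  + apply/imsetP => -[i _ Ni].
    by have := ss_mem fS i; rewrite -Ni inE.
- move=> _ /imsetP[k _ ->] i j ik jk; rewrite !(ss_supp fS).
  by rewrite -(N_eq _ _ ik) -(N_eq _ _ jk) -(w_eq _ _ ik) -(w_eq _ _ jk).
- move=> _ _ /imsetP[k _ ->] /imsetP[k' _ ->] kk' i j ik jk'.
  by rewrite !(ss_supp fS) -(N_eq _ _ ik) -(N_eq _ _ jk') N_disj.
Qed.
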